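(* Let $Z=(X,Y)\in\mathfrak X_S$. There exists an affine change of coordinates applied to both half-spaces, preserving $\{z\ge0\}$ and $\{z<0\}$ and commuting with $S$, together with a positive amplitude rescaling and a positive linear rescaling of time, such that the transformed Filippov system has the form $Z_\kappa=(X_\kappa,Y_\kappa)$ for some real constants $\lambda,\mu,H,\kappa$, where $$X_\kappa(x,y,z)=\bigl(\lambda x-\kappa y-\{H[(\lambda-\mu)^2+1]-\lambda\kappa\}z+H,\ 2\mu y-(\mu^2+1)z+1,\ y\bigr),\qquad Y_\kappa=S\circ X_\kappa\circ S.$$ Here $\lambda$ is the normalized real eigenvalue, the remaining eigenvalues of $DX_\kappa$ are $\mu\pm i$, $H$ is the inclination of the focal line $r^X=\{(x,y,0)\in\Sigma:x=Hy\}$, and the corresponding focal plane is $$W_\kappa^X=\{(x,y,z)\in\mathbb R^3: x-Hy+[\kappa+H(2\mu-\lambda)]z=0\}.$$ Moreover, the shears $T_+^\kappa(x,y,z)=(x+\kappa z,y,z)$ on $\{z\ge0\}$ and $T_-^\kappa(x,y,z)=(x,y+\kappa z,z)$ on $\{z\le 0\}$ satisfy $T_-^\kappa=S\circ T_+^\kappa\circ S$, agree with the identity on $\Sigma$, and send $Z_\kappa$ to $Z_0$ (that is, $(T_+^\kappa)_*X_\kappa=X_0$ and $(T_-^\kappa)_*Y_\kappa=Y_0$), where $$X_0(x,y,z)=\bigl(\lambda x-H\bigl(((\lambda-\mu)^2+1)z-1\bigr),\ 2\mu y-(\mu^2+1)z+1,\ y\bigr),\qquad Y_0=S\circ X_0\circ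 S.$$ The focal plane of $X_0$ is $W_0^X=\{x-Hy+H(2\mu-\lambda)z=0\}$. The systems $Z_\kappa$ and $Z_0$ have the same smooth flight times and flight endpoints on $\Sigma$ (for flights of $X_\kappa$, resp. $X_0$, in $z>0$ and of $Y_\kappa$, resp. $Y_0$, in $z<0$ between points of $\Sigma$), and therefore induce the same section maps on $\Sigma$ wherever these maps are defined.
   Context: Let $f(x,y,z)=z$, $\Sigma=\{z=0\}\subset\mathbb R^3$, $S(x,y,z)=(-y,-x,-z)$. For affine vector fields $X,Y$ on $\mathbb R^3$, $Z=(X,Y)$ is the piecewise-linear Filippov system equal to $X$ on $\{z\ge0\}$ and $Y$ on $\{z<0\}$; $Xf=\langle X,\nabla f\rangle$, $X^2f=X(Xf)$, and similarly for $Y$. Put $\Sigma^{\rm c}=\{p\in\Sigma:Xf(p)Yf(p)>0\}$, $L_X=\{p\in\Sigma:Xf(p)=0\}$, $L_Y=\{p\in\Sigma:Yf(p)=0\}$. $Z\in\mathfrak X_S$ means: (i) $DX$ and $DY$ each have a nonzero real eigenvalue and a pair of nonreal complex-conjugate eigenvalues; (ii) $L_X,L_Y$ are lines, $X^2f>0$ on $L_X$ and $Y^2f<0$ on $L_Y$ (all points are visible folds); (iii) if $W^X,W^Y$ (focal planes) are the invariant affine planes associated with the complex eigenvalue pairs and $r^X=W^X\cap\Sigma$, $r^Y=W^Y\cap\Sigma$ (focal lines), then $L_X,L_Y,r^X,r^Y$ are pairwise distinct lines concurrent at a point $p_\ast\in\Sigma$, and $r^X\setminus\{p_\ast\}$,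 $r^Y\setminus\{p_\ast\}\subset\Sigma^{\rm c}$; (iv) $Y=S\circ X\circ S$. *)

(* Defs.v *)
From mathcomp Require Export all_boot all_order all_algebra all_field.
From mathcomp Require Export complex.
From mathcomp Require Export all_classical all_reals all_analysis.
Export Order.TTheory GRing.Theory Num.Theory numFieldNormedType.Exports.

Set Implicit Arguments.
Unset Strict Implicit.
Unset Printing Implicit Defensive.

Local Open Scope classical_set_scope.
Local Open Scope ring_scope.

(* Points and vectors of R^3 are row vectors, the library's convention for
   Jacobians: v *m 'J F p is the differential of F at p applied to v.  Hence
   eigenvectors of DX are row eigenvectors of 'J X, as in [eigenvalue]. *)

Section Space.
Variable R : realType.
Implicit Types (p q v : 'rV[R]_3) (X F : 'rV[R]_3 -> 'rV[R]_3).

Definition vec3 (x y z : R) : 'rV[R]_3 := \row_i [:: x; y; z]`_i.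

Definition xc p : R := p 0 ord0.
Definition yc p : R := p 0 1.
Definition zc p : R := p 0 ord_max.

Definition Sigma : set 'rV[R]_3 := [set p | zc p = 0].
Definition upper_closed : set 'rV[R]_3 := [set p | 0 <= zc p].
Definition upper_open : set 'rV[R]_3 := [set p | 0 < zc p].
Definition lower_open : set 'rV[R]_3 := [set p | zc p < 0].

Definition flip p : 'rV[R]_3 := vec3 (- yc p) (- xc p) (- zc p).

Definition affine F : Prop :=
  exists (A : 'M[R]_3) (b : 'rV[R]_3), forall p, F p = p *m A + b.

Definition grad (g : 'rV[R]_3 -> R) p : 'rV[R]_3 :=
  \row_i 'D_(delta_mx 0 i) g p.

Definition lie X (g : 'rV[R]_3 -> R) p : R :=
  \sum_(i < 3) X p 0 i * grad g p 0 i.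

(* Xf and X^2f for f(x,y,z) = z. *)
Definition lie_f X : 'rV[R]_3 -> R := lie X zc.
Definition lie2_f X : 'rV[R]_3 -> R := lie X (lie X zc).

Definition tangency X : set 'rV[R]_3 := [set p | Sigma p /\ lie_f X p = 0].

Definition is_line (L : set 'rV[R]_3) : Prop :=
  exists p0 v, v != 0 /\ L = [set p | exists t : R, p = p0 + t *: v].

(* Constant in p when X is affine. *)
Definition D X : 'M[R]_3 := 'J X (0 : 'rV[R]_3).

Definition complexify m n (A : 'M[R]_(m, n)) : 'M[R[i]]_(m, n) :=
  map_mx (real_complex R) A.

(* W is an affine plane, parallel to the real plane spanned by the real and
   imaginary parts of an eigenvector of DX for a nonreal eigenvalue, and X is
   tangent to W along W. *)
Definition focal_plane X (W : set 'rV[R]_3) : Prop :=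
  exists (p0 : 'rV[R]_3) (ev : R[i]) (w : 'rV[R[i]]_3),
    let V := (map_mx (@complex.Re R) w + map_mx (@complex.Im R) w)%MS in
    [/\ complex.Im ev != 0,
        w != 0 /\ w *m complexify (D X) = ev *: w,
        W = [set p | (p - p0 <= V)%MS] &
        forall p, W p -> (X p <= V)%MS].

Definition focal_spectrum X : Prop :=
  (exists l : R, l != 0 /\ eigenvalue (D X) l) /\
  (exists a b : R, [/\ b != 0,
     eigenvalue (complexify (D X)) (a +i* b)%C &
     eigenvalue (complexify (D X)) (a -i* b)%C]).

(* F is a change of variables carrying the field X to the field X'. *)
Definition pushes F X X' : Prop :=
  bijective F /\ forall p, 'd F p (X p) = X' (F p).

(* A trajectory of X of duration t > 0 from p in Sigma to q in Sigma, lying in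
   O at all intermediate times. *)
Definition flight X (O : set 'rV[R]_3) (t : R) p q : Prop :=
  [/\ 0 < t, Sigma p, Sigma q &
   exists g : R -> 'rV[R]_3,
     [/\ g 0 = p, g t = q, {within `[0, t], continuous g} &
      forall s, 0 < s -> s < t -> is_derive s 1 g (X (g s)) /\ O (g s)]].

End Space.

(* The piecewise system equal to [upper] on z >= 0 and to [lower] on z < 0. *)
Record filippov (R : realType) := Filippov {
  upper : 'rV[R]_3 -> 'rV[R]_3;
  lower : 'rV[R]_3 -> 'rV[R]_3 }.

Section Systems.
Variable R : realType.
Implicit Types (Z : filippov R) (p q : 'rV[R]_3).

Definition crossing Z : set 'rV[R]_3 :=
  [set p | Sigma p /\ 0 < lie_f (upper Z) p * lie_f (lower Z) p].

Definition class_S Z : Prop :=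
  let X := upper Z in let Y := lower Z in
  let LX := tangency X in let LY := tangency Y in
  [/\ affine X /\ affine Y,
      focal_spectrum X /\ focal_spectrum Y,
      [/\ is_line LX, is_line LY,
          forall p, LX p -> 0 < lie2_f X p &
          forall p, LY p -> lie2_f Y p < 0],
      exists WX WY : set 'rV[R]_3,
        let rX := WX `&` @Sigma R in let rY := WY `&` @Sigma R in
        [/\ focal_plane X WX /\ focal_plane Y WY,
            is_line rX /\ is_line rY,
            [/\ LX <> LY, LX <> rX & LX <> rY] /\
            [/\ LY <> rX, LY <> rY & rX <> rY] &
            exists p0 : 'rV[R]_3,
              [/\ Sigma p0,
                  [/\ LX p0, LY p0, rX p0 & rY p0],
                  rX `\ p0 `<=` crossing Z &
                  rY `\ p0 `<=` crossing Z]] &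
      Y = @flip R \o X \o @flip R].

Definition upper_flight Z := flight (upper Z) (@upper_open R).
Definition lower_flight Z := flight (lower Z) (@lower_open R).

(* Section maps are partial maps Sigma -> Sigma, given by their graphs: the two
   half-maps, and the two return maps obtained by composing them through a
   crossing point. *)
Definition upper_map Z p q : Prop := exists t, upper_flight Z t p q.
Definition lower_map Z p q : Prop := exists t, lower_flight Z t p q.
Definition return_map_up Z p q : Prop :=
  exists m, [/\ upper_map Z p m, crossing Z m & lower_map Z m q].
Definition return_map_down Z p q : Prop :=
  exists m, [/\ lower_map Z p m, crossing Z m & upper_map Z m q].

Variables (lam mu H kappa : R).

Definition Xk p : 'rV[R]_3 :=
  let x := xc p in let y := yc p in let z := zc p in
  vec3 (lam * x - kappa * y
          - (H * ((lam - mu) ^+ 2 + 1) - lam * kappa) * z + H)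
       (2 * mu * y - (mu ^+ 2 + 1) * z + 1)
       y.

Definition Zk : filippov R := Filippov Xk (@flip R \o Xk \o @flip R).

Definition X0 p : 'rV[R]_3 :=
  let x := xc p in let y := yc p in let z := zc p in
  vec3 (lam * x - H * (((lam - mu) ^+ 2 + 1) * z - 1))
       (2 * mu * y - (mu ^+ 2 + 1) * z + 1)
       y.

Definition Z0 : filippov R := Filippov X0 (@flip R \o X0 \o @flip R).

Definition Wk : set 'rV[R]_3 :=
  [set p | xc p - H * yc p + (kappa + H * (2 * mu - lam)) * zc p = 0].

Definition W0 : set 'rV[R]_3 :=
  [set p | xc p - H * yc p + H * (2 * mu - lam) * zc p = 0].

Definition Tplus p : 'rV[R]_3 := vec3 (xc p + kappa * zc p) (yc p) (zc p).
Definition Tminus p : 'rV[R]_3 := vec3 (xc p) (yc p + kappa * zc p) (zc p).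

End Systems.

(* Main.v *)
Require Import Defs.
From mathcomp Require Import ring lra.

(** The chart is dictated by what the normal form says about it.  In [Xk] the
    height z moves with velocity y, so y has to be a multiple of Xf, z a
    multiple of f, and x, which is the image of y under the symmetry, a multiple
    of Xf composed with the symmetry: [chart_mx].  The three functionals are
    independent because L_X and L_Y are distinct lines through a common point,
    which is then fixed by the symmetry ([tangency_transverse],
    [common_fold_flip]).

    In this chart, with the common point p0 at the origin, two facts determine
    all remaining coefficients.
    - Along L_X the function X^2f is affine and positive, hence constant: the
      second component of the field does not contain x ([fold_line_visible]).
    - The focal plane W is invariant and contains p0, so h = X(p0) is a vector
      of the real plane V spanned by the real and imaginary parts of a complex
      eigenvector.  On V the matrix A of the field satisfies the quadratic
      relation of its complex eigenvalue a + ib ([focal_recurrence]):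
      h A^2 = 2a (h A) - (a^2 + b^2) h.
    With |b|t as the new time and the amplitude chosen so that X^2f(p0) becomes
    1, the three coordinates of that relation are the three missing equations
    ([normal_form_entries]): they give trace 2 mu and determinant mu^2 + 1 of
    the (y, z)-block, and the z-coefficient of the first component, H being the
    x-coordinate of the rescaled h.  The lower field follows because the chart
    commutes with the symmetry ([pushes_flip]).

    The shear by k turns the parameter kappa into kappa - k, is the identity on
    Sigma and preserves heights, so it maps flights to flights with the same
    time and endpoints ([flight_affine]).  All claims about Z_0 are thus claims
    about Z_kappa at kappa = 0, and flights agree for any two values of kappa. *)

Set Implicit Arguments.
Unset Strict Implicit.
Unset Printing Implicit Defensive.

Local Open Scope classical_set_scope.
Local Open Scope ring_scope.

(** * Coordinates and three-dimensional matrices *)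

Section Coordinates.
Variable R : realType.
Implicit Types (p q v : 'rV[R]_3) (A : 'M[R]_3).

Lemma xc_vec3 (x y z : R) : xc (vec3 x y z) = x. Proof. by rewrite /xc mxE. Qed.
Lemma yc_vec3 (x y z : R) : yc (vec3 x y z) = y. Proof. by rewrite /yc mxE. Qed.
Lemma zc_vec3 (x y z : R) : zc (vec3 x y z) = z. Proof. by rewrite /zc mxE. Qed.

Lemma ord3 (P : 'I_3 -> Prop) : P ord0 -> P 1 -> P ord_max -> forall i, P i.
Proof.
move=> P0 P1 P2 [[|[|[|//]]] lti]; [move: P0|move: P1|move: P2];
  by congr P; apply: val_inj.
Qed.

Lemma coordP p q : xc p = xc q -> yc p = yc q -> zc p = zc q -> p = q.
Proof. by move=> ex ey ez; apply/rowP; exact: ord3. Qed.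

Lemma zcD p q : zc (p + q) = zc p + zc q. Proof. by rewrite /zc mxE. Qed.
Lemma zcZ (k : R) p : zc (k *: p) = k * zc p. Proof. by rewrite /zc mxE. Qed.
Lemma xcD p q : xc (p + q) = xc p + xc q. Proof. by rewrite /xc mxE. Qed.
Lemma ycD p q : yc (p + q) = yc p + yc q. Proof. by rewrite /yc mxE. Qed.
Lemma xcZ (k : R) p : xc (k *: p) = k * xc p. Proof. by rewrite /xc mxE. Qed.
Lemma ycZ (k : R) p : yc (k *: p) = k * yc p. Proof. by rewrite /yc mxE. Qed.
Lemma xcN p : xc (- p) = - xc p. Proof. by rewrite /xc mxE. Qed.
Lemma ycN p : yc (- p) = - yc p. Proof. by rewrite /yc mxE. Qed.
Lemma zcN p : zc (- p) = - zc p. Proof. by rewrite /zc mxE. Qed.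

Lemma mulmx3 (S : pzSemiRingType) (v : 'rV[S]_3) (B : 'M[S]_3) j :
  (v *m B) 0 j = v 0 ord0 * B ord0 j + v 0 1 * B 1 j + v 0 ord_max * B ord_max j.
Proof.
rewrite mxE !big_ord_recr big_ord0 /= add0r.
by congr (v 0 _ * B _ j + v 0 _ * B _ j + v 0 _ * B _ j); apply: val_inj.
Qed.

Lemma xcM v A :
  xc (v *m A) = xc v * A ord0 ord0 + yc v * A 1 ord0 + zc v * A ord_max ord0.
Proof. exact: mulmx3. Qed.
Lemma ycM v A : yc (v *m A) = xc v * A ord0 1 + yc v * A 1 1 + zc v * A ord_max 1.
Proof. exact: mulmx3. Qed.
Lemma zcM v A : zc (v *m A) =
  xc v * A ord0 ord_max + yc v * A 1 ord_max + zc v * A ord_max ord_max.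
Proof. exact: mulmx3. Qed.

Definition coordE := (xcD, ycD, zcD, xcZ, ycZ, zcZ, xcN, ycN, zcN, xc_vec3,
  yc_vec3, zc_vec3).

Definition rows3 (r0 r1 r2 : 'rV[R]_3) : 'M[R]_3 :=
  \matrix_(i, j) ([:: r0; r1; r2]`_i) 0 j.

Lemma mul_rows3 v r0 r1 r2 :
  v *m rows3 r0 r1 r2 = xc v *: r0 + yc v *: r1 + zc v *: r2.
Proof. by apply/rowP => j; rewrite mulmx3 !mxE. Qed.

Lemma sub_span2 p u v : (p <= u + v)%MS <-> exists r t : R, p = r *: u + t *: v.
Proof.
split=> [/sub_addsmxP[[a b] /= ->]|[r [t ->]]].
  by exists (a 0 0), (b 0 0); rewrite -!mul_scalar_mx -!mx11_scalar.
by apply: addmx_sub_adds; exact: scalemx_sub.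
Qed.

End Coordinates.

(** * Calculus of affine maps *)

Section AffineCalculus.
Variable R : realType.

Lemma mulmxr_differentiable m n (A : 'M[R]_(m, n)) p :
  differentiable (fun q : 'rV[R]_m => q *m A) p.
Proof.
have -> : (fun q : 'rV[R]_m => q *m A) =
    \sum_(i < m) (fun q : 'rV[R]_m => q 0 i *: row i A).
  by apply/funext => q; rewrite mulmx_sum_row fct_sumE.
apply: differentiable_sum => i.
by apply: differentiableZl; exact: differentiable_coord.
Qed.

Lemma derive_affine (V W : normedModType R) (g : V -> W) p v l :
  (forall h, g (h *: v + p) = h *: l + g p) -> 'D_v g p = l.
Proof.
move=> gE; apply: cvg_lim => //; apply: cvg_near_cst.
near=> h; rewrite /= gE addrK scalerA mulVf ?scale1r//.
by near: h; exact: nbhs_dnbhs_neq.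
Unshelve. all: by end_near. Qed.

Lemma affine_differentiable m n (F : 'rV[R]_m -> 'rV[R]_n) A b p :
  (forall p, F p = p *m A + b) ->
  differentiable F p /\ forall v, 'd F p v = v *m A.
Proof.
move=> FE; have dF : differentiable F p.
  have -> : F = (fun q => q *m A) + cst b by apply/funext => q; rewrite FE.
  apply: differentiableD; last exact: differentiable_cst.
  exact: mulmxr_differentiable.
split=> // v; rewrite -deriveE//; apply: derive_affine => h.
by rewrite !FE mulmxDl -scalemxAl addrA.
Qed.

Lemma affine_bijective n (F : 'rV[R]_n -> 'rV[R]_n) A b :
  A \in unitmx -> (forall p, F p = p *m A + b) -> bijective F.
Proof.
move=> Au FE; exists (fun q => (q - b) *m invmx A) => p.
  by rewrite FE addrK mulmxK.
by rewrite FE mulmxKV// subrK.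
Qed.

Implicit Types (p q v : 'rV[R]_3) (X F T : 'rV[R]_3 -> 'rV[R]_3).

Lemma D_affine F (A : 'M[R]_3) b : (forall p, F p = p *m A + b) -> D F = A.
Proof.
move=> FE; have [_ dF] := affine_differentiable 0 FE.
by apply/row_matrixP => i; rewrite rowE [RHS]rowE /D /jacobian mul_rV_lin1 dF.
Qed.

Lemma lie_affine X (g : 'rV[R]_3 -> R) (A : 'M[R]_3) (b : R) p :
  (forall q, g q = zc (q *m A) + b) -> lie X g p = zc (X p *m A).
Proof.
move=> gE; rewrite /lie /zc mxE; apply: eq_bigr => i _; congr (_ * _).
rewrite mxE; apply: derive_affine => h.
rewrite !gE mulmxDl zcD -scalemxAl zcZ addrA -rowE; congr (_ * _ + _ + _).
by rewrite /zc mxE.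
Qed.

Lemma lie_fE X p : lie_f X p = zc (X p).
Proof.
rewrite -[X p]mulmx1; apply: (@lie_affine _ _ _ 0) => q.
by rewrite mulmx1 addr0.
Qed.

Lemma lie2_fE X (A : 'M[R]_3) b p : (forall p, X p = p *m A + b) ->
  lie2_f X p = zc (X p *m A).
Proof.
move=> XE; apply: (@lie_affine _ _ _ (zc b)) => q.
by rewrite -/(lie_f X q) lie_fE XE zcD.
Qed.

(** T carries trajectories of X to trajectories of X' with the same time
    parameter, and fixing Sigma pointwise keeps their endpoints. *)
Lemma flight_affine X X' (O : set 'rV[R]_3) T (A : 'M[R]_3) b t p q :
  (forall p, T p = p *m A + b) -> pushes T X X' ->
  (forall p, Sigma p -> T p = p) -> (forall p, O p -> O (T p)) ->
  flight X O t p q -> flight X' O t p q.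
Proof.
move=> TE [_ XX'] Tid TO [t0 Sp Sq [g [g0 gt cg dg]]]; split=> //.
exists (T \o g); split=> /=; rewrite ?g0 ?gt ?Tid//.
  move=> x; apply: (@continuous_comp (subspace _) _ _ g T); first exact: cg.
  exact/differentiable_continuous/(affine_differentiable _ TE).1.
move=> s s0 st; have [[gs gsE] Ogs] := dg s s0 st; split; last exact: TO.
have [dT _] := affine_differentiable (g s) TE.
have dgs : differentiable g s by exact/derivable1_diffP.
have dTg := differentiable_comp dgs dT.
split; first exact: diff_derivable.
by rewrite deriveE// diff_comp//= -(deriveE _ dgs) gsE XX'.
Qed.

End AffineCalculus.

(** * Linear algebra at a focal plane *)

Section Focal.
Variable R : realType.
Implicit Types (h p q v : 'rV[R]_3) (A N : 'M[R]_3) (w : 'rV[R[i]]_3).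

Lemma Re_mulmx w A : map_mx (@complex.Re R) (w *m complexify A) =
  map_mx (@complex.Re R) w *m A.
Proof.
apply/rowP => j; rewrite mxE !mulmx3 !mxE.
by case: (w 0 _) (w 0 _) (w 0 _) => [? ?] [? ?] [? ?] /=; rewrite !mulr0 !subr0.
Qed.

Lemma Im_mulmx w A : map_mx (@complex.Im R) (w *m complexify A) =
  map_mx (@complex.Im R) w *m A.
Proof.
apply/rowP => j; rewrite mxE !mulmx3 !mxE.
by case: (w 0 _) (w 0 _) (w 0 _) => [? ?] [? ?] [? ?] /=; rewrite !mulr0 !add0r.
Qed.

(** On the real plane spanned by the real and imaginary parts of w, A acts as
    multiplication by the eigenvalue, hence satisfies the real quadratic
    polynomial of which that eigenvalue is a root. *)
Lemma focal_recurrence A (al be : R) w h :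
  w *m complexify A = (al +i* be)%C *: w ->
  (h <= map_mx (@complex.Re R) w + map_mx (@complex.Im R) w)%MS ->
  h *m A *m A = (2 * al) *: (h *m A) - (al ^+ 2 + be ^+ 2) *: h.
Proof.
move=> we; set u := map_mx _ w; set v := map_mx _ w.
have uA : u *m A = al *: u - be *: v.
  rewrite -Re_mulmx we; apply/rowP => j; rewrite !mxE.
  by case: (w 0 j).
have vA : v *m A = al *: v + be *: u.
  rewrite -Im_mulmx we; apply/rowP => j; rewrite !mxE.
  by case: (w 0 j).
have stepA (r t : R) : (r *: u + t *: v) *m A =
    (al * r + be * t) *: u + (al * t - be * r) *: v.
  rewrite mulmxDl -!scalemxAl uA vA; apply/rowP => j; rewrite !mxE; ring.
by move=> /sub_span2[r [t ->]]; rewrite !stepA;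
  apply/rowP => j; rewrite !mxE; ring.
Qed.

(** The hypotheses say what the chart achieves: the height has velocity c y, the
    second component has no x-term, and the field at the origin is h.  The
    recurrence on h, read coordinate by coordinate, is triangular in the unknown
    entries: z gives the trace of the (y, z)-block, then y its determinant, then
    x the entry in position (z, x). *)
Lemma normal_form_entries N h (c al : R) : 0 < c ->
  (forall v, zc (v *m N) = c * yc v) -> yc (vec3 1 0 0 *m N) = 0 ->
  yc h = c -> zc h = 0 ->
  h *m N *m N = (2 * al) *: (h *m N) - (al ^+ 2 + c ^+ 2) *: h ->
  exists lam mu H kappa, (forall q, q *m N + h = c *: Xk lam mu H kappa q) /\
    vec3 1 0 0 *m N = (c * lam) *: vec3 1 0 0.
Proof.
move=> c0 zN yN hy hz hNN; have cn0 : c != 0 by rewrite gt_eqF.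
have [N02 N12 N22] : [/\ N ord0 ord_max = 0, N 1 ord_max = c &
    N ord_max ord_max = 0].
  by split; [have := zN (vec3 1 0 0) | have := zN (vec3 0 1 0) |
    have := zN (vec3 0 0 1)];
    rewrite zcM !coordE ?(mul0r, mul1r, mulr0, mulr1, add0r, addr0).
have N01 : N ord0 1 = 0.
  by move: yN; rewrite ycM !coordE ?(mul0r, mul1r, mulr0, mulr1, add0r, addr0).
have := congr1 (@zc R) hNN; have := congr1 (@yc R) hNN; have := congr1 (@xc R) hNN.
rewrite !coordE !(xcM, ycM, zcM) hy hz N01 N02 N12 N22.
rewrite !(mul0r, mul1r, mulr0, mulr1, add0r, addr0).
set a := N ord0 ord0; set b := N 1 ord0; set d := N ord_max ord0.
set m := N 1 1; set n := N ord_max 1; set x := xc h => ex ey ez.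
have mE : m = 2 * al by apply: (mulIf cn0); apply: (mulIf cn0); lra.
have nE : n = - (al ^+ 2 + c ^+ 2) / c.
  apply: (mulIf cn0); apply: (mulIf cn0); rewrite divfK//.
  by move: ey; rewrite mE => ey; lra.
have dE : d = (- (a ^+ 2 * x / c) - a * b + 2 * al * a * x / c
    - (al ^+ 2 + c ^+ 2) * x / c) / c.
  apply: (mulIf cn0); apply: (mulIf cn0); rewrite divfK//.
  move: ex; rewrite mE => ex.
  have -> : d * c * c = 2 * al * (x * a + c * b) - (al ^+ 2 + c ^+ 2) * x
     - (x * a + c * b) * a - c * (2 * al) * b by lra.
  by field.
exists (a / c), (al / c), (x / c), (- (b / c)); split=> [q|]; apply: coordP;
 rewrite !coordE !(xcM, ycM, zcM) ?(hy, hz, N01, N02, N12, N22) ?coordE -/a -/b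
   -/d -/m -/n -/x ?dE ?mE ?nE; by field.
Qed.

End Focal.

Section Eigen.
Variable F : fieldType.

(** The x-axis is an invariant line, so B is block triangular: its eigenvalues
    are l and those of the (y, z)-block.  Away from e = l the x-coordinate of an
    eigenvector is solved for, whatever the entries left free in B. *)
Lemma eigenvalue_block (B : 'M[F]_3) (l m d : F) (e : F) :
  B ord0 ord0 = l -> B ord0 1 = 0 -> B ord0 ord_max = 0 ->
  B 1 1 = m -> B 1 ord_max = 1 -> B ord_max 1 = - d -> B ord_max ord_max = 0 ->
  eigenvalue B e <-> e = l \/ e ^+ 2 - m * e + d = 0.
Proof.
move=> B00 B01 B02 B11 B12 B21 B22.
split=> [/eigenvalueP[v ve v0]|].
  have e0 := congr1 (fun u : 'rV_3 => u 0 ord0) ve.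
  have e1 := congr1 (fun u : 'rV_3 => u 0 1) ve.
  have e2 := congr1 (fun u : 'rV_3 => u 0 ord_max) ve.
  move: e0 e1 e2; rewrite /= !mulmx3 !mxE B00 B01 B02 B11 B12 B21 B22.
  rewrite !(mulr0, mulr1, add0r, addr0) => e0 e1 e2.
  have [z0|z0] := eqVneq (v 0 ord_max) 0.
    left; have y0 : v 0 1 = 0 by rewrite e2 z0 mulr0.
    have x0 : v 0 ord0 != 0.
      apply: contra v0 => /eqP x0; apply/eqP/rowP => i; rewrite mxE.
      by move: i; apply: ord3.
    by apply: (mulIf x0); rewrite -e0 y0 z0 !mul0r !addr0 mulrC.
  right; apply: (mulIf z0); rewrite mul0r.
  move: e1; rewrite e2 => e1.
  have -> : (e ^+ 2 - m * e + d) * v 0 ord_max =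
    e * (e * v 0 ord_max) - (e * v 0 ord_max * m + v 0 ord_max * - d) by ring.
  by rewrite e1 subrr.
have [-> _|el] := eqVneq e l.
  apply/eigenvalueP; exists (delta_mx 0 ord0).
    rewrite -rowE; apply/rowP; apply: ord3;
      by rewrite !mxE ?B00 ?B01 ?B02 /= ?mulr0 ?mulr1.
  by apply/eqP => /rowP/(_ ord0)/eqP; rewrite !mxE /= oner_eq0.
move=> [/eqP|qe]; first by rewrite (negPf el).
have el0 : e - l != 0 by rewrite subr_eq0.
apply/eigenvalueP; exists
  (\row_i [:: (e * B 1 ord0 + B ord_max ord0) / (e - l); e; 1]`_i).
  apply/rowP; apply: ord3; rewrite mulmx3 !mxE /= ?(B00, B01, B02, B11, B12, B21, B22).
  - by field.
  - apply/eqP; rewrite mulr0 add0r mul1r eq_sym -subr_eq0; apply/eqP.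
    by rewrite -qe; ring.
  - by rewrite !mulr0 !mulr1 add0r addr0.
by apply/eqP => /rowP/(_ ord_max)/eqP; rewrite !mxE /= oner_eq0.
Qed.

End Eigen.

(** * The symmetry *)

Section Flip.
Variable R : realType.
Implicit Types (p q v : 'rV[R]_3) (X T : 'rV[R]_3 -> 'rV[R]_3).

Definition flip_mx : 'M[R]_3 :=
  rows3 (vec3 0 (- 1) 0) (vec3 (- 1) 0 0) (vec3 0 0 (- 1)).

Lemma flipE p : flip p = p *m flip_mx.
Proof. by rewrite mul_rows3; apply: coordP; rewrite !coordE; ring. Qed.

Lemma flipK : involutive (@flip R).
Proof. by move=> p; apply: coordP; rewrite !coordE opprK. Qed.

Lemma flip_mxK : flip_mx *m flip_mx = 1%:M.
Proof.
by apply/row_matrixP => i; rewrite !rowE mulmx1 mulmxA -!flipE flipK.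
Qed.

Lemma flipZ (k : R) p : flip (k *: p) = k *: flip p.
Proof. by rewrite !flipE scalemxAl. Qed.

(** Conjugation by the symmetry transfers every statement about the upper field
    to the lower one; it is used both for charts commuting with the symmetry and
    for the two shears, which it exchanges. *)
Lemma pushes_flip T (A : 'M[R]_3) b X X' :
  (forall p, T p = p *m A + b) -> pushes T X X' ->
  pushes (@flip R \o T \o @flip R) (@flip R \o X \o @flip R)
    (@flip R \o X' \o @flip R).
Proof.
move=> TE [Tbij TX].
have flip_bij : bijective (@flip R) := inv_bij flipK.
have fTfE p : (@flip R \o T \o @flip R) p =
    p *m (flip_mx *m A *m flip_mx) + b *m flip_mx.
  by rewrite /= !flipE TE mulmxDl !mulmxA.
split=> [|p]; first exact: (bij_comp (bij_comp flip_bij Tbij) flip_bij).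
rewrite (affine_differentiable p fTfE).2 /= flipK -TX.
rewrite (affine_differentiable _ TE).2 !flipE !mulmxA.
by rewrite -[_ *m flip_mx *m flip_mx]mulmxA flip_mxK mulmx1.
Qed.

End Flip.

(** * The normal form and its shears *)

Section NormalForm.
Variable R : realType.
Variables (lam mu H : R).
Implicit Types (p q v : 'rV[R]_3) (kappa : R).

Definition Xk_mx kappa : 'M[R]_3 := rows3
  (vec3 lam 0 0) (vec3 (- kappa) (2 * mu) 1)
  (vec3 (- (H * ((lam - mu) ^+ 2 + 1) - lam * kappa)) (- (mu ^+ 2 + 1)) 0).

Lemma XkE kappa p : Xk lam mu H kappa p = p *m Xk_mx kappa + vec3 H 1 0.
Proof. by rewrite mul_rows3; apply: coordP; rewrite !coordE; ring. Qed.

Lemma X0E : X0 lam mu H = Xk lam mu H 0.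
Proof. by apply/funext => p; apply: coordP; rewrite !coordE; ring. Qed.

Lemma Z0E : Z0 lam mu H = Zk lam mu H 0.
Proof. by rewrite /Z0 /Zk X0E. Qed.

Lemma W0E : W0 lam mu H = Wk lam mu H 0.
Proof. by rewrite /Wk add0r. Qed.

Lemma spectrum_Xk kappa (e : R[i]) :
  eigenvalue (complexify (D (Xk lam mu H kappa))) e <->
  [\/ e = (lam +i* 0)%C, e = (mu +i* 1)%C | e = (mu -i* 1)%C].
Proof.
rewrite (D_affine (XkE kappa)).
rewrite (@eigenvalue_block _ _ (real_complex R lam) (real_complex R (2 * mu))
  (real_complex R (mu ^+ 2 + 1))); try by rewrite !mxE //= ?rmorphN.
have -> : e ^+ 2 - real_complex R (2 * mu) * e + real_complex R (mu ^+ 2 + 1) =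
    (e - (mu +i* 1)%C) * (e - (mu -i* 1)%C).
  by case: e => x y; apply/eqP; rewrite eq_complex /=; apply/andP; split;
    apply/eqP; ring.
split=> [[->|/eqP]|[->|->|->]].
- by constructor 1.
- by rewrite mulf_eq0 !subr_eq0 => /orP[]/eqP->; [constructor 2|constructor 3].
- by left.
- by right; rewrite subrr mul0r.
- by right; rewrite subrr mulr0.
Qed.

(** The eigenvector of mu + i has z = 1 and y = mu + i because z' = y; its
    x-coordinate j + iH is the one for which its real and imaginary parts lie in
    the plane. *)
Lemma focal_plane_Xk kappa : focal_plane (Xk lam mu H kappa) (Wk lam mu H kappa).
Proof.
pose j := H * (mu - (2 * mu - lam)) - kappa.
pose w : 'rV[R[i]]_3 := \row_i [:: (j +i* H)%C; (mu +i* 1)%C; (1 +i* 0)%C]`_i.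
have Vp p : (p <= map_mx (@complex.Re R) w + map_mx (@complex.Im R) w)%MS <->
    Wk lam mu H kappa p.
  have -> : map_mx (@complex.Re R) w = vec3 j mu 1.
    by apply/rowP; apply: ord3; rewrite !mxE.
  have -> : map_mx (@complex.Im R) w = vec3 H 1 0.
    by apply/rowP; apply: ord3; rewrite !mxE.
  rewrite sub_span2; split=> [[r [t ->]]|Wp].
    by rewrite /Wk /= !coordE /j; ring.
  (* z determines the real part, and y what is left for the imaginary part *)
  exists (zc p), (yc p - mu * zc p); apply: coordP; rewrite !coordE /j; last 2 first.
  - by ring.
  - by ring.
  by move: Wp; rewrite /Wk /=; lra.
exists 0, (mu +i* 1)%C, w; split.
- exact: oner_neq0.
- split.
    by apply/eqP => /rowP/(_ ord_max)/eqP; rewrite !mxE eq_complex /= oner_eq0.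
  rewrite (D_affine (XkE kappa)); apply/rowP; apply: ord3;
    rewrite mulmx3 !mxE /=; apply/eqP; rewrite eq_complex /=;
    by apply/andP; split; apply/eqP; rewrite /j; ring.
- by apply/seteqP; split=> p /=; rewrite subr0 Vp.
- move=> p Wp; apply/Vp; move: Wp; rewrite /Wk /= !coordE => Wp.
  rewrite -[RHS](mulr0 lam) -Wp; ring.
Qed.

Lemma Wk_Sigma kappa : Wk lam mu H kappa `&` @Sigma R =
  [set p | zc p = 0 /\ xc p = H * yc p].
Proof.
apply/seteqP; split=> p; rewrite /Wk /Sigma /=.
  by case=> Wp z0; split=> //; move: Wp; rewrite z0; lra.
by case=> z0 xy; split=> //; rewrite z0 xy; ring.
Qed.

Definition shear_mx kappa : 'M[R]_3 :=
  rows3 (vec3 1 0 0) (vec3 0 1 0) (vec3 kappa 0 1).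

Lemma TplusE kappa p : Tplus kappa p = p *m shear_mx kappa + 0.
Proof. by rewrite addr0 mul_rows3; apply: coordP; rewrite !coordE; ring. Qed.

Lemma TminusE kappa : Tminus kappa = @flip R \o Tplus kappa \o @flip R.
Proof. by apply/funext => p; apply: coordP; rewrite !coordE; ring. Qed.

(** Since z' = y, replacing x by x + k z adds k y to its velocity: the only effect
    on the normal form is to change kappa. *)
Lemma pushes_Tplus kappa k :
  pushes (Tplus k) (Xk lam mu H kappa) (Xk lam mu H (kappa - k)).
Proof.
split=> [|p].
  by exists (Tplus (- k)) => p; apply: coordP; rewrite /Tplus !coordE; ring.
rewrite (affine_differentiable p (TplusE k)).2 mul_rows3.
by apply: coordP; rewrite !coordE; ring.
Qed.

Lemma pushes_Tminus kappa k :
  pushes (Tminus k) (lower (Zk lam mu H kappa))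
    (lower (Zk lam mu H (kappa - k))).
Proof. by rewrite TminusE; apply: pushes_flip (TplusE k) (pushes_Tplus _ _). Qed.

Lemma shear_Sigma k p : Sigma p -> Tplus k p = p /\ Tminus k p = p.
Proof.
by rewrite /Sigma /= => z0; split; apply: coordP; rewrite !coordE ?z0; ring.
Qed.

Lemma upper_flight_kappa k1 k2 t p q :
  upper_flight (Zk lam mu H k1) t p q -> upper_flight (Zk lam mu H k2) t p q.
Proof.
move=> f; apply: (flight_affine (TplusE (k1 - k2)) _ _ _ f) =>
  [|r /(shear_Sigma (k1 - k2))[]//|r].
  by rewrite -[X in pushes _ _ (Xk _ _ _ X)](subKr k1); exact: pushes_Tplus.
by rewrite /upper_open /= zc_vec3.
Qed.

Lemma lower_flight_kappa k1 k2 t p q :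
  lower_flight (Zk lam mu H k1) t p q -> lower_flight (Zk lam mu H k2) t p q.
Proof.
have TE r : Tminus (k1 - k2) r =
    r *m (flip_mx R *m shear_mx (k1 - k2) *m flip_mx R) + 0.
  by rewrite TminusE /= !flipE TplusE !addr0 !mulmxA.
move=> f; apply: (flight_affine TE _ _ _ f) =>
  [|r /(shear_Sigma (k1 - k2))[]//|r].
  rewrite -[X in pushes _ _ (lower (Zk _ _ _ X))](subKr k1).
  exact: pushes_Tminus.
by rewrite /lower_open /= zc_vec3.
Qed.

(** The crossing region only involves the heights of the two fields, which do not
    see kappa. *)
Lemma crossing_Zk kappa p :
  crossing (Zk lam mu H kappa) p <-> Sigma p /\ 0 < yc p * xc p.
Proof. by rewrite /crossing /= !lie_fE /= !coordE opprK. Qed.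

End NormalForm.

(** * The chart at the common point of the fold lines *)

Section TwoFold.
Variable R : realType.
Variables (X : 'rV[R]_3 -> 'rV[R]_3) (A : 'M[R]_3) (b : 'rV[R]_3).
Implicit Types (p q v : 'rV[R]_3).
Hypothesis XE : forall p, X p = p *m A + b.
Let Y := @flip R \o X \o @flip R.
Let a0 := A ord0 ord_max.
Let a1 := A 1 ord_max.

Lemma tangency_upper p : tangency X p <->
  zc p = 0 /\ a0 * xc p + a1 * yc p + zc b = 0.
Proof.
rewrite /tangency /Sigma /= lie_fE XE zcD zcM -/a0 -/a1.
by split=> -[z0]; rewrite z0 => e; split=> //; lra.
Qed.

Lemma tangency_lower p : tangency Y p <->
  zc p = 0 /\ a0 * yc p + a1 * xc p - zc b = 0.
Proof.
rewrite /tangency /Sigma /= lie_fE.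
have -> : zc (Y p) = - zc (X (flip p)) by rewrite zc_vec3.
rewrite XE zcD zcM !coordE -/a0 -/a1.
by split=> -[z0]; rewrite z0 => e; split=> //; lra.
Qed.

(** In Sigma the lines have normals (a0, a1) and (a1, a0); if these are parallel,
    lines with a common point coincide. *)
Lemma tangency_transverse p : tangency X p -> tangency Y p ->
  tangency X <> tangency Y -> a0 ^+ 2 - a1 ^+ 2 != 0.
Proof.
move=> /tangency_upper[_ Xp] /tangency_lower[_ Yp] XY.
apply/eqP => /eqP; rewrite subr_sqr mulf_eq0 => /orP[] /eqP a01; apply: XY;
  apply/seteqP; split=> q /=; rewrite tangency_upper tangency_lower => -[-> e];
  split=> //; move: a01 Xp Yp e; clear; nra.
Qed.

(** Adding the equations of the two lines gives (a0 + a1)(x + y) = 0. *)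
Lemma common_fold_flip p : tangency X p -> tangency Y p ->
  a0 ^+ 2 - a1 ^+ 2 != 0 -> flip p = p.
Proof.
move=> /tangency_upper[z0 Xp] /tangency_lower[_ Yp].
rewrite subr_sqr mulf_eq0 negb_or => /andP[_ a01].
have xy : xc p = - yc p.
  by apply/eqP; rewrite -subr_eq0 opprK; apply/eqP/(mulfI a01); lra.
by apply: coordP; rewrite !coordE ?z0 ?oppr0// xy opprK.
Qed.

Lemma affine_pos_slope (m k : R) : (forall t, 0 < m + t * k) -> 0 < m /\ k = 0.
Proof.
move=> pos; split; first by have := pos 0; rewrite mul0r addr0.
apply/eqP; apply: contraT => k0.
by have := pos (- m / k); rewrite divfK// subrr ltxx.
Qed.

(** L_X has direction (a1, -a0, 0), and an affine function that is positive on a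
    whole line has slope zero along it. *)
Lemma fold_line_visible p : tangency X p ->
  (forall q, tangency X q -> 0 < lie2_f X q) ->
  0 < zc (X p *m A) /\ zc (vec3 a1 (- a0) 0 *m A *m A) = 0.
Proof.
move=> Xp vis; apply: affine_pos_slope => t.
have [z0 Xpe] := (tangency_upper p).1 Xp.
have /vis : tangency X (p + t *: vec3 a1 (- a0) 0).
  apply/tangency_upper; rewrite !coordE z0; split; first by ring.
  by lra.
rewrite (lie2_fE _ XE); have -> : X (p + t *: vec3 a1 (- a0) 0) =
    X p + t *: (vec3 a1 (- a0) 0 *m A).
  by rewrite !XE mulmxDl -scalemxAl addrAC.
by rewrite mulmxDl -scalemxAl zcD zcZ.
Qed.

Variables (p0 : 'rV[R]_3) (c al : R).
Hypothesis c_gt0 : 0 < c.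
Hypothesis p0_fold : tangency X p0.
Hypothesis p0_flip : flip p0 = p0.
Hypothesis a01 : a0 ^+ 2 - a1 ^+ 2 != 0.
Hypothesis p0_visible : 0 < zc (X p0 *m A).
Hypothesis slope0 : zc (vec3 a1 (- a0) 0 *m A *m A) = 0.
Hypothesis focal : X p0 *m A *m A =
  (2 * al) *: (X p0 *m A) - (al ^+ 2 + c ^+ 2) *: X p0.

(* Makes the velocity of the new y equal to c at p0. *)
Let amp := c / zc (X p0 *m A).
Let g := A ord_max ord_max.
(** The columns are Xf composed with the symmetry, up to sign and constants, then
    the linear part of Xf, then c f: with c t as the new time, the new y is
    the velocity of the new z. *)
Definition chart_mx := rows3 (vec3 a1 a0 0) (vec3 a0 a1 0) (vec3 g g c).
Definition chart p := (p - p0) *m chart_mx.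
Let P := chart_mx.

Lemma chart_affine p : chart p = p *m P + - (p0 *m P).
Proof. by rewrite /chart mulmxBl. Qed.

Lemma yc_chart_mx v : yc (v *m P) = zc (v *m A).
Proof. by rewrite mul_rows3 !coordE zcM -/a0 -/a1 -/g; ring. Qed.

Lemma zc_chart_mx v : zc (v *m P) = c * zc v.
Proof. by rewrite mul_rows3 !coordE; ring. Qed.

Lemma chart_mx_unit : P \in unitmx.
Proof.
rewrite -row_free_unit; apply: inj_row_free => v vP.
have c0 : c != 0 by rewrite gt_eqF.
have z0 : zc v = 0 by apply: (mulfI c0); rewrite -zc_chart_mx vP /zc mxE mulr0.
have := congr1 (@xc R) vP; have := congr1 (@yc R) vP.
rewrite !mul_rows3 !coordE z0 /xc /yc !mxE -/(xc v) -/(yc v) => y0 x0.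
apply: coordP; rewrite /xc /yc /zc mxE -/(xc v) -/(yc v) -/(zc v) //;
  apply: (mulIf a01); rewrite mul0r.
  transitivity (a0 * (xc v * a0 + yc v * a1 + 0 * g) -
    a1 * (xc v * a1 + yc v * a0 + 0 * g)); first ring.
  by rewrite y0 x0 !mulr0 subrr.
transitivity (a0 * (xc v * a1 + yc v * a0 + 0 * g) -
  a1 * (xc v * a0 + yc v * a1 + 0 * g)); first ring.
by rewrite y0 x0 !mulr0 subrr.
Qed.

Lemma chart_flip : chart \o @flip R = @flip R \o chart.
Proof.
apply/funext => p; rewrite /= /chart -{1}p0_flip.
by apply: coordP; rewrite /P !(mul_rows3, coordE); ring.
Qed.

Lemma zc_chart p : zc (chart p) = c * zc p.
Proof.
have [z0 _] := p0_fold.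
by rewrite /chart zc_chart_mx !coordE (z0 : zc p0 = 0) subr0.
Qed.

Lemma image_chart (S : set R) : (forall z, S (c * z) <-> S z) ->
  chart @` [set p | S (zc p)] = [set p | S (zc p)].
Proof.
move=> cS; apply/seteqP; split=> [_ [p Sp <-]|q Sq] /=.
  by rewrite zc_chart cS.
have [f _ fK] := affine_bijective chart_mx_unit chart_affine.
by exists (f q) => //=; rewrite -cS -zc_chart fK.
Qed.

(** The conjugate N of A by the chart meets the hypotheses of
    [normal_form_entries]; its first row shows that c lam is an eigenvalue. *)
Lemma chart_normal_form : exists lam mu H kappa,
  pushes (fun p => amp *: chart p) X (fun q => c *: Xk lam mu H kappa q) /\
  eigenvalue A (c * lam).
Proof.
have Pu := chart_mx_unit; have amp0 : amp != 0.
  by rewrite /amp mulf_neq0 ?invr_eq0 ?gt_eqF.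
pose N := invmx P *m A *m P; pose h := amp *: (X p0 *m P).
have PN v : v *m P *m N = v *m A *m P by rewrite /N !mulmxA mulmxK.
(* The chart sends the direction of L_X to the x-axis. *)
have e0E : vec3 1 0 0 = (a1 ^+ 2 - a0 ^+ 2)^-1 *: (vec3 a1 (- a0) 0 *m P).
  have a10 : a1 ^+ 2 - a0 ^+ 2 != 0 by rewrite -oppr_eq0 opprB.
  by rewrite mul_rows3; apply: coordP; rewrite !coordE; field.
have [||||||lam [mu [H [kappa [NE e0N]]]]] := @normal_form_entries R N h c al.
- exact: c_gt0.
- by move=> v; rewrite /N !mulmxA zc_chart_mx -yc_chart_mx mulmxKV.
- by rewrite e0E -scalemxAl PN ycZ yc_chart_mx slope0 mulr0.
- by rewrite /h ycZ yc_chart_mx /amp divfK// gt_eqF.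
- have [_] := p0_fold; rewrite lie_fE => Xp0.
  by rewrite /h zcZ zc_chart_mx Xp0 !mulr0.
- rewrite /h -!scalemxAl !PN focal mulmxBl -!scalemxAl scalerBr !scalerA.
  by congr (_ *: _ - _ *: _); rewrite mulrC.
exists lam, mu, H, kappa; split.
  have TE p : amp *: chart p = p *m (amp *: P) + - (p0 *m (amp *: P)).
    by rewrite chart_affine scalerDr scalerN -!scalemxAr.
  split=> [|p]; first by apply: affine_bijective TE; rewrite unitmxZ ?unitfE.
  rewrite (affine_differentiable p TE).2 -NE /chart /h -scalemxAl PN.
  rewrite -scalerDr -mulmxDl -scalemxAr; congr (_ *: (_ *m _)).
  by rewrite !XE mulmxBl addrA subrK.
apply/eigenvalueP; exists (vec3 1 0 0 *m invmx P).
  by rewrite scalemxAl -e0N -mulmxA -[LHS](mulmxK Pu) /N !mulmxA.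
apply/eqP => /(congr1 (mulmx^~ P)); rewrite mulmxKV// mul0mx.
by move=> /rowP/(_ ord0)/eqP; rewrite !mxE oner_eq0.
Qed.

End TwoFold.

Theorem proposition2 (R : realType) (Z : filippov R) (hZ : class_S Z) :
  exists (Phi : 'rV[R]_3 -> 'rV[R]_3) (amp c lam mu H kappa : R),
    let T := fun p => amp *: Phi p in
    let zk := Zk lam mu H kappa in
    let z0 := Z0 lam mu H in
    (* normal form: new coordinates T p, new time c * t *)
    ([/\ affine Phi /\ bijective Phi,
         Phi @` @upper_closed R = @upper_closed R /\
           Phi @` @lower_open R = @lower_open R,
         Phi \o @flip R = @flip R \o Phi,
         0 < amp /\ 0 < c &
         pushes T (upper Z) (fun q => c *: upper zk q) /\
           pushes T (lower Z) (fun q => c *: lower zk q)])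
    /\
    (* meaning of the constants *)
    ([/\ eigenvalue (D (upper Z)) (c * lam),
         forall e : R[i], eigenvalue (complexify (D (upper zk))) e <->
           [\/ e = (lam +i* 0)%C, e = (mu +i* 1)%C | e = (mu -i* 1)%C],
         focal_plane (upper zk) (Wk lam mu H kappa) &
         Wk lam mu H kappa `&` @Sigma R =
           [set p | zc p = 0 /\ xc p = H * yc p]])
    /\
    (* the shears *)
    ([/\ Tminus kappa = @flip R \o Tplus kappa \o @flip R,
         forall p, Sigma p -> Tplus kappa p = p /\ Tminus kappa p = p,
         pushes (Tplus kappa) (upper zk) (upper z0),
         pushes (Tminus kappa) (lower zk) (lower z0) &
         focal_plane (upper z0) (W0 lam mu H)])
    /\
    (* flights and section maps *)
    ((forall t p q, upper_flight zk t p q <-> upper_flight z0 t p q) /\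
     (forall t p q, lower_flight zk t p q <-> lower_flight z0 t p q) /\
     (forall p q, upper_map zk p q <-> upper_map z0 p q) /\
     (forall p q, lower_map zk p q <-> lower_map z0 p q) /\
     (forall p q, return_map_up zk p q <-> return_map_up z0 p q) /\
     (forall p q, return_map_down zk p q <-> return_map_down z0 p q)).
Proof.
case: Z hZ => X Y; rewrite /class_S /= => -[[[A [b XE]] _] _ [_ _ visX _]].
case=> [WX [WY [[focX _] _ [[LXY _ _] _]]]].
move=> [p0 [_ [LXp0 LYp0 [WXp0 _] _] _ _]] YE.
(* The frequency |Im| of the focal eigenvalue is the time scale. *)
case: focX => q0 [[al be] [w [be0 [_ we] _ WXV]]].
subst Y.
have a01 := tangency_transverse XE LXp0 LYp0 LXY.
have p0_flip := common_fold_flip XE LXp0 LYp0 a01.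
have [vis0 slope0] := fold_line_visible XE LXp0 visX.
have focal : X p0 *m A *m A =
    (2 * al) *: (X p0 *m A) - (al ^+ 2 + `|be| ^+ 2) *: X p0.
  rewrite (D_affine XE) in we.
  by rewrite real_normK ?num_real//; exact: focal_recurrence we (WXV _ WXp0).
have c_gt0 : 0 < `|be| by rewrite normr_gt0.
have [lam [mu [H [kappa [XT eA]]]]] :=
  chart_normal_form XE c_gt0 LXp0 a01 vis0 slope0 focal.
set amp := _ / _ in XT; set Phi := chart A p0 `|be| in XT.
have PhiE := chart_affine A p0 `|be|.
have Phi_bij : bijective Phi := affine_bijective (chart_mx_unit c_gt0 a01) PhiE.
have Phi_flip : Phi \o @flip R = @flip R \o Phi by exact: chart_flip.
have Phi_image := image_chart c_gt0 LXp0 a01.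
exists Phi, amp, `|be|, lam, mu, H, kappa; cbv zeta; rewrite Z0E W0E.
split; [split=> // | split; [split | split; [split | ]]].
- by split=> //; eexists; eexists; exact: PhiE.
- split; first by apply: (Phi_image [set z | 0 <= z]) => z; rewrite /= pmulr_rge0.
  by apply: (Phi_image [set z | z < 0]) => z; rewrite /= pmulr_rlt0.
- by split=> //; rewrite divr_gt0.
- split=> //=; pose T p := amp *: Phi p.
  have TE p : T p = p *m (amp *: chart_mx A `|be|) +
      amp *: - (p0 *m chart_mx A `|be|).
    by rewrite /T [Phi p]PhiE scalerDr -scalemxAr.
  have fTf : @flip R \o T \o @flip R = T.
    apply/funext => p; rewrite /= /T -[Phi (flip p)]/((Phi \o @flip R) p) Phi_flip.
    by rewrite /= flipZ flipK.
  have := pushes_flip TE XT; rewrite fTf.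
  have -> // : @flip R \o (fun q => `|be| *: Xk lam mu H kappa q) \o @flip R =
      (fun q => `|be| *: lower (Zk lam mu H kappa) q).
  by apply/funext => q; rewrite /= flipZ.
- by rewrite /= (D_affine XE).
- exact: spectrum_Xk.
- exact: focal_plane_Xk.
- exact: Wk_Sigma.
- exact: TminusE.
- exact: shear_Sigma.
- by have := pushes_Tplus lam mu H kappa kappa; rewrite subrr X0E.
- by have := pushes_Tminus lam mu H kappa kappa; rewrite subrr X0E.
- by rewrite /= X0E; exact: focal_plane_Xk.
have uf t p q : upper_flight (Zk lam mu H kappa) t p q <->
    upper_flight (Zk lam mu H 0) t p q by split; exact: upper_flight_kappa.
have lf t p q : lower_flight (Zk lam mu H kappa) t p q <->
    lower_flight (Zk lam mu H 0) t p q by split; exact: lower_flight_kappa.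
have um p q : upper_map (Zk lam mu H kappa) p q <->
    upper_map (Zk lam mu H 0) p q by split=> -[t /uf]; exists t.
have lm p q : lower_map (Zk lam mu H kappa) p q <->
    lower_map (Zk lam mu H 0) p q by split=> -[t /lf]; exists t.
have cr p : crossing (Zk lam mu H kappa) p <-> crossing (Zk lam mu H 0) p.
  by rewrite !crossing_Zk.
split; [exact: uf | split; [exact: lf | split; [exact: um | split; [exact: lm|]]]].
split.
  by move=> p q; split=> -[m [/um ? /cr ? /lm ?]]; exists m.
by move=> p q; split=> -[m [/lm ? /cr ? /um ?]]; exists m.
Qed.
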